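(* Let $r,s>0$ and let $\{X_t,t\ge0\}$ be the bilateral birth-death process with alternating rates $(r,s)$ on $\mathbb Z$, i.e. the birth-death process on $\mathbb Z$ with birth rates $\beta_i$ and death rates $\alpha_i$ given by $\beta_{2n}=\alpha_{2n+1}=r$ and $\beta_{2n+1}=\alpha_{2n}=s$ for all $n\in\mathbb Z$. Let $\tau$ be the first returning time to $0$ of the process started at $0$. Then for $a>0$, $E(\tau^a)<\infty$ if and only if $0<a<\frac12$.
   Context: The process is the continuous-time Markov chain on $\mathbb Z$ with $Q$-matrix $q_{i,i+1}=\beta_i$, $q_{i,i-1}=\alpha_i$, $q_{ii}=-(\alpha_i+\beta_i)$, and $q_{ij}=0$ for $|i-j|>1$. $\tau=\inf\{t>\eta_1:X_t=0\}$, where $\eta_1$ is the first jump time and $X_0=0$; $E$ is expectation for the process started at $0$. *)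

(* Defs.v *)
From HB Require Import structures.
From mathcomp Require Import all_boot all_order all_algebra.
From mathcomp Require Import all_classical all_reals all_analysis.

Set Implicit Arguments.
Unset Strict Implicit.
Unset Printing Implicit Defensive.

Import Order.TTheory GRing.Theory Num.Theory.
Import numFieldNormedType.Exports.

Local Open Scope classical_set_scope.
Local Open Scope ring_scope.

(* Times are reals; only the values of a trajectory [x : R -> int] at
   nonnegative times are ever used. *)
Section Trajectory.
Context {R : realType}.
Implicit Types x : R -> int.

(* Right-continuity on [0, +oo) for the discrete topology of Z. *)
Definition right_continuous_path x : Prop :=
  forall t, 0 <= t ->
    exists2 e : R, 0 < e & forall u, t <= u < t + e -> x u = x t.

(* eta_0 = 0 and eta_{n+1} = inf {t >= eta_n : x_t <> x_{eta_n}}, where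
   inf set0 = +oo; in particular eta_{n+1} = +oo when eta_n = +oo. *)
Fixpoint jump_time x (n : nat) : \bar R :=
  if n is m.+1 then
    ereal_inf [set t%:E | t in
      [set t : R | (jump_time x m <= t%:E)%E /\ x t <> x (fine (jump_time x m))]]
  else 0%E.

(* Y_n = x_{eta_n}, frozen after the last jump if there is one. *)
Fixpoint jump_chain x (n : nat) : int :=
  if n is m.+1 then
    if jump_time x n is t%:E then x t else jump_chain x m
  else x 0.

(* [holding_time x n] is S_{n+1} = eta_{n+1} - eta_n, the time spent in Y_n.
   The test is needed because +oo - +oo = -oo in \bar R. *)
Definition holding_time x (n : nat) : \bar R :=
  if jump_time x n is t%:E then (jump_time x n.+1 - t%:E)%E else +oo%E.

Definition return_time (i : int) x : \bar R :=
  ereal_inf [set t%:E | t in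
    [set t : R | (jump_time x 1 < t%:E)%E /\ x t = i]].

End Trajectory.

Section MarkovChain.
Context {R : realType}.
Implicit Types (lambda : int -> R) (Q : int -> int -> R).

Definition exit_rate Q (i : int) : R := - Q i i.

Definition jump_matrix Q (i j : int) : R :=
  if exit_rate Q i == 0 then (i == j)%:R
  else if i == j then 0 else Q i j / exit_rate Q i.

(* Jump chain / holding time definition of a right-continuous Markov chain on
   Z with initial distribution [lambda] and (stable, conservative) Q-matrix
   [Q]: the jump chain is a discrete-time Markov chain with transition matrix
   [jump_matrix Q], and, given Y_0, ..., Y_{n-1}, the holding times
   S_1, ..., S_n are independent, exponential of parameters
   exit_rate Y_0, ..., exit_rate Y_{n-1} (parameter 0 meaning S = +oo).
   This determines the law of X up to its explosion time, which is almost
   surely +oo when the exit rates are bounded. *)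
Record ctmc {d : measure_display} {T : measurableType d} (P : probability T R)
    lambda Q (X : R -> T -> int) : Prop := Ctmc {
  ctmc_measurable : forall t, 0 <= t ->
    forall i : int, measurable [set w | X t w = i] ;
  ctmc_right_continuous : forall w, right_continuous_path (X^~ w) ;
  ctmc_jump_chain : forall (n : nat) (i : nat -> int),
    P [set w | forall k, (k <= n)%N -> jump_chain (X^~ w) k = i k] =
    (lambda (i 0%N) * \prod_(k < n) jump_matrix Q (i k) (i k.+1))%:E ;
  ctmc_holding_times : forall (n : nat) (i : nat -> int) (t : nat -> R),
    (forall k, 0 <= t k) ->
    P [set w | forall k, (k < n)%N ->
         jump_chain (X^~ w) k = i k /\
         ((t k)%:E < holding_time (X^~ w) k)%E] =
    (P [set w | forall k, (k < n)%N -> jump_chain (X^~ w) k = i k] *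
     (\prod_(k < n) expR (- (exit_rate Q (i k) * t k)))%:E)%E }.

Definition birth_death_Q (beta alpha : int -> R) (i j : int) : R :=
  if j == i + 1 then beta i
  else if j == i - 1 then alpha i
  else if j == i then - (alpha i + beta i)
  else 0.

Definition alternating_birth (r s : R) (i : int) : R :=
  if (2 %| i)%Z then r else s.

Definition alternating_death (r s : R) (i : int) : R :=
  if (2 %| i)%Z then s else r.

End MarkovChain.

(* Main.v *)
Require Import Defs.
From HB Require Import structures.
From mathcomp Require Import all_boot all_order all_algebra.
From mathcomp Require Import all_classical all_reals all_analysis.
From mathcomp Require Import measurable_realfun.
From mathcomp Require Import zify ring lra.

(* All exit rates equal c = r + s, so the holding times are i.i.d. of rate c
   and independent of the jump chain Y. Let N be the return time of Y to 0:
   on {N = n} one has tau = S_1 + ... + S_n, and first moments of the S_k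
   suffice to compare E(tau^a; N = n) with n^a P(N = n) from above (a <= 1) and
   from below (a = 1/2). It remains to study the law f of N. With
   p = r/c and q = s/c, the chain observed at even times is twice a lazy
   symmetric walk of step probability pq, for which rho^|k| is harmonic up to
   the factor 1/z^2 = 1 + pq (1 - rho)^2 / rho. This identifies the generating
   function F(z) of f along the curve z = z(rho) and shows that 1 - F(z) is of
   order eps = 1 - rho while 1 - z is of order eps^2. The upper bound on 1 - F
   along eps = 2^-j gives the finiteness of E(N^a) for a < 1/2; if E(N^(1/2))
   were finite, 1 - z^n <= min(n eps^2, n^(1/2) eps) would give
   1 - F(z) = o(eps), contradicting the lower bound. *)

Set Implicit Arguments.
Unset Strict Implicit.
Unset Printing Implicit Defensive.

Import Order.TTheory GRing.Theory Num.Theory.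
Import numFieldNormedType.Exports.

Local Open Scope classical_set_scope.
Local Open Scope ring_scope.

(** * The generating function of the return time of the jump chain *)

Section FirstReturn.
Context {R : realType} (p q : R).

Definition step_up (x : int) : R := if (2 %| x)%Z then p else q.
Definition step_down (x : int) : R := if (2 %| x)%Z then q else p.

(** First-step recursion for the probability that the jump chain started at [x] visits 0 for the
    first time at step exactly [n]. *)
Fixpoint hit_prob (n : nat) (x : int) : R :=
  if n is m.+1 then
    if x == 0 then 0
    else step_up x * hit_prob m (x + 1) + step_down x * hit_prob m (x - 1)
  else (x == 0)%:R.

Definition return_prob (n : nat) : R :=
  if n is m.+1 then p * hit_prob m 1 + q * hit_prob m (- 1) else 0.

Hypotheses (p0 : 0 < p) (q0 : 0 < q) (pq1 : p + q = 1).

Lemma step_up_gt0 x : 0 < step_up x.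
Proof. by rewrite /step_up; case: ifP. Qed.

Lemma step_down_gt0 x : 0 < step_down x.
Proof. by rewrite /step_down; case: ifP. Qed.

Lemma step_sum x : step_up x + step_down x = 1.
Proof. by rewrite /step_up /step_down; case: ifP => _ //; rewrite addrC. Qed.

Lemma hit_prob_ge0 n x : 0 <= hit_prob n x.
Proof.
elim: n x => [|n IH] x /=; first by rewrite ler0n.
case: ifP => // _.
by rewrite addr_ge0 // mulr_ge0 // ltW // (step_up_gt0, step_down_gt0).
Qed.

Lemma return_prob_ge0 n : 0 <= return_prob n.
Proof. by case: n => //= n; rewrite addr_ge0 // mulr_ge0 ?hit_prob_ge0 // ltW. Qed.

(** * A harmonic function for the walk discounted by [z] *)

Section Harmonic.
Variables rho : R.
Hypotheses (rho0 : 0 < rho) (rho1 : rho <= 1).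

Let w : R := (1 + p * q * (1 - rho) ^+ 2 / rho)^-1.
Let z : R := Num.sqrt w.

Lemma weight_denom_ge1 : 1 <= 1 + p * q * (1 - rho) ^+ 2 / rho.
Proof.
by rewrite lerDl divr_ge0 ?(ltW rho0) // mulr_ge0 ?sqr_ge0 // mulr_ge0 // ltW.
Qed.

Lemma weight_gt0 : 0 < w.
Proof. by rewrite invr_gt0 (lt_le_trans ltr01 weight_denom_ge1). Qed.

Lemma weight_le1 : w <= 1.
Proof.
by rewrite invf_le1 ?weight_denom_ge1 // (lt_le_trans ltr01 weight_denom_ge1).
Qed.

Lemma root_sqr : z ^+ 2 = w. Proof. exact/sqr_sqrtr/ltW/weight_gt0. Qed.

Lemma root_gt0 : 0 < z. Proof. by rewrite sqrtr_gt0 weight_gt0. Qed.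

Lemma root_le1 : z <= 1.
Proof. by rewrite -sqrtr1 ler_sqrt // weight_le1. Qed.

(* The values at odd sites are forced by those at even sites; the equation at
   even sites is then the one solved by [rho ^+ `|k|] for the two-step walk. *)
Definition harmonic (x : int) : R :=
  if (2 %| x)%Z then rho ^+ `|(x %/ 2)%Z|
  else z * (q * rho ^+ `|((x + 1) %/ 2)%Z| + p * rho ^+ `|((x - 1) %/ 2)%Z|).

Lemma even_double (k : int) : (2 %| 2 * k)%Z. Proof. lia. Qed.
Lemma odd_doubleD1 (k : int) : (2 %| 2 * k + 1)%Z = false. Proof. lia. Qed.

Lemma harmonic_even k : harmonic (2 * k) = rho ^+ `|k|.
Proof. by rewrite /harmonic even_double; congr (_ ^+ _); lia. Qed.

Lemma harmonic_odd k : harmonic (2 * k + 1) =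
  z * (q * harmonic (2 * (k + 1)) + p * harmonic (2 * k)).
Proof.
rewrite !harmonic_even /harmonic odd_doubleD1.
by congr (_ * (_ * _ ^+ _ + _ * _ ^+ _)); lia.
Qed.

Lemma int_parity (x : int) : (exists k, x = 2 * k) \/ (exists k, x = 2 * k + 1).
Proof.
case: (boolP (2 %| x)%Z) => h; [left|right]; exists (x %/ 2)%Z; lia.
Qed.

(** This equation dictates [w]: since [p ^+ 2 + q ^+ 2 = 1 - 2pq], dividing by the power of [rho]
    leaves [w^-1 = 1 - 2pq + pq (rho + rho^-1)]. It needs [k != 0], where one neighbour has a larger
    exponent and the other a smaller one. *)
Lemma geometric_harmonic (k : int) : k != 0 ->
  rho ^+ `|k| = w * ((p ^+ 2 + q ^+ 2) * rho ^+ `|k|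
    + p * q * (rho ^+ `|k + 1| + rho ^+ `|k - 1|)).
Proof.
move=> k0; have [n hn] : exists n, `|k|%N = n.+1 by exists `|k|.-1; lia.
have -> : rho ^+ `|k + 1| + rho ^+ `|k - 1| = rho ^+ n.+2 + rho ^+ n.
  case: (ltP 0 k) => hk; first by congr (_ ^+ _ + _ ^+ _); lia.
  have {}hk : k < 0 by rewrite lt_neqAle k0.
  by rewrite [LHS]addrC; congr (_ ^+ _ + _ ^+ _); lia.
rewrite hn; apply: (@mulfI _ w^-1); first by rewrite invr_eq0 gt_eqF ?weight_gt0.
rewrite mulKf ?gt_eqF ?weight_gt0 // invrK !exprS.
have -> : q = 1 - p by rewrite -pq1; ring.
by field; rewrite gt_eqF.
Qed.

Lemma harmonic0 : harmonic 0 = 1.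
Proof. by rewrite -[0](mulr0 2) harmonic_even. Qed.

Lemma harmonic_step x : x != 0 -> harmonic x =
  z * (step_up x * harmonic (x + 1) + step_down x * harmonic (x - 1)).
Proof.
rewrite /step_up /step_down; case: (int_parity x) => -[k ->] k0.
- rewrite even_double harmonic_odd.
  have -> : 2 * k - 1 = 2 * (k - 1) + 1 :> int by ring.
  rewrite harmonic_odd subrK !harmonic_even.
  rewrite {1}geometric_harmonic; last first.
    by apply: contraNneq k0 => ->; rewrite mulr0.
  by rewrite -root_sqr; ring.
- rewrite odd_doubleD1 addrK harmonic_odd; congr (_ * (_ * harmonic _ + _)).
  by ring.
Qed.

Lemma harmonic_ge0 x : 0 <= harmonic x.
Proof.
have h n : 0 <= rho ^+ n by rewrite exprn_ge0 // ltW.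
rewrite /harmonic; case: ifP => // _.
by rewrite mulr_ge0 ?sqrtr_ge0 // addr_ge0 // mulr_ge0 // ltW.
Qed.

Lemma harmonic_le1 x : harmonic x <= 1.
Proof.
have h n : rho ^+ n <= 1 by rewrite exprn_ile1 // ltW.
rewrite /harmonic; case: ifP => // _.
rewrite mulr_ile1 ?sqrtr_ge0 ?root_le1 //.
  by rewrite addr_ge0 // mulr_ge0 ?exprn_ge0 // ltW.
by rewrite -pq1 addrC lerD // ger_pMr.
Qed.

(** Optional stopping for [z ^+ n * harmonic (Y n)] at the hitting time of 0, unrolled as an
    induction on [n]. Walks not yet absorbed after [n] steps contribute between 0 and [z ^+ n],
    because [harmonic] takes values in [0, 1]. *)
Lemma hit_prob_gf n x :
  \sum_(m < n.+1) z ^+ m * hit_prob m x <= harmonic x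
    <= \sum_(m < n.+1) z ^+ m * hit_prob m x + z ^+ n.
Proof.
elim: n x => [|n IH] x.
  rewrite big_ord_recl big_ord0 /= expr0 mul1r addr0.
  have := harmonic_ge0 x; have := harmonic_le1 x.
  by case: eqP => [->|_]; rewrite ?harmonic0 /=; lra.
rewrite big_ord_recl /= expr0 mul1r.
case: eqVneq => [->|x0]; rewrite /bump /=.
  rewrite harmonic0 big1; last by move=> i _; rewrite mulr0.
  by rewrite addr0 lexx lerDl exprn_ge0 // ltW // root_gt0.
rewrite add0r harmonic_step //.
set S := \sum_(m < n.+1) _.
have -> : S = z * (step_up x * \sum_(m < n.+1) z ^+ m * hit_prob m (x + 1)
    + step_down x * \sum_(m < n.+1) z ^+ m * hit_prob m (x - 1)).
  rewrite !mulr_sumr -big_split mulr_sumr; apply: eq_bigr => i _ /=.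
  by rewrite add1n exprS; ring.
have /andP[a1 a2] := IH (x + 1); have /andP[b1 b2] := IH (x - 1).
have u0 := ltW (step_up_gt0 x); have d0 := ltW (step_down_gt0 x).
have z0 := ltW root_gt0.
rewrite exprS -mulrDr !ler_wpM2l //=; last first.
  by apply: lerD; rewrite ler_wpM2l.
rewrite -[X in _ <= _ + X]mul1r -(step_sum x) mulrDl addrACA -!mulrDr.
by apply: lerD; rewrite ler_wpM2l.
Qed.

Let F := w * (1 - 2 * (p * q) * (1 - rho)).

(** Conditioning on the first step turns [hit_prob_gf] at 1 and -1 into bounds for the return time.
    The value of [F] comes from [p (p + q rho) + q (q + p rho) = 1 - 2pq (1 - rho)]. *)
Lemma return_prob_gf n :
  \sum_(m < n.+2) z ^+ m * return_prob m <= F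
    <= \sum_(m < n.+2) z ^+ m * return_prob m + z ^+ n.+1.
Proof.
have -> : F = z * (p * harmonic 1 + q * harmonic (-1)).
  have := harmonic_odd 0; rewrite mulr0 !add0r => ->.
  have -> : harmonic (-1) = harmonic (2 * (-1) + 1) by [].
  rewrite harmonic_odd addNr mulr0 harmonic0 !harmonic_even /= expr1.
  rewrite /F -root_sqr; have -> : q = 1 - p by rewrite -pq1; ring.
  by ring.
rewrite big_ord_recl /= mulr0 add0r.
have -> : \sum_(i < n.+1) z ^+ bump 0 i
      * (p * hit_prob i 1 + q * hit_prob i (-1)) =
    z * (p * \sum_(m < n.+1) z ^+ m * hit_prob m 1
       + q * \sum_(m < n.+1) z ^+ m * hit_prob m (-1)).
  rewrite !mulr_sumr -big_split mulr_sumr; apply: eq_bigr => i _ /=.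
  by rewrite /bump add1n exprS; ring.
have /andP[a1 a2] := hit_prob_gf n 1; have /andP[b1 b2] := hit_prob_gf n (-1).
have p0' := ltW p0; have q0' := ltW q0; have z0 := ltW root_gt0.
rewrite exprS -mulrDr !ler_wpM2l //=; last by apply: lerD; rewrite ler_wpM2l.
rewrite -[X in _ <= _ + X]mul1r -pq1 mulrDl addrACA -!mulrDr.
by apply: lerD; rewrite ler_wpM2l.
Qed.

End Harmonic.

(** * The generating function as [z] tends to 1 *)

Lemma pq_le_quarter : p * q <= 4^-1.
Proof.
have -> : q = 1 - p by rewrite -pq1; ring.
by have := sqr_ge0 (p - 2^-1); nra.
Qed.

(** Specialisation to [rho = 1 - e]. The bound on [1 - z] serves to bound [1 - z ^+ n] from above;
    the last clause serves to bound it from below as soon as [n * e ^+ 2] is of order 1. *)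
Lemma return_prob_gf_eps (e : R) : 0 < e <= 2^-1 -> exists z F : R,
  [/\ 0 < z < 1,
      forall n, \sum_(m < n.+2) z ^+ m * return_prob m <= F
        <= \sum_(m < n.+2) z ^+ m * return_prob m + z ^+ n.+1,
      p * q * e / 2 <= 1 - F <= e,
      1 - z <= e ^+ 2 &
      forall n, (1 + n%:R * (p * q * e ^+ 2)) * z ^+ n ^+ 2 <= 1].
Proof.
move=> /andP[e0 e2].
have r0 : 0 < 1 - e by lra.
have r1 : 1 - e <= 1 by lra.
pose x := p * q * e ^+ 2 / (1 - e).
pose w := (1 + x)^-1; pose z : R := Num.sqrt w.
have b0 : 0 < p * q by rewrite mulr_gt0.
have b4 := pq_le_quarter.
have e20 : 0 < e ^+ 2 by rewrite exprn_gt0.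
have xE : x * (1 - e) = p * q * e ^+ 2 by rewrite /x divfK // gt_eqF.
have x0 : 0 < x by rewrite divr_gt0 // mulr_gt0.
have xge : p * q * e ^+ 2 <= x by nra.
have xle : x <= e ^+ 2 / 2 by nra.
have wE : w * (1 + x) = 1 by rewrite /w mulVf ?gt_eqF ?addr_gt0.
have w0 : 0 < w by rewrite invr_gt0 addr_gt0.
have w1 : w < 1 by nra.
have z0 : 0 < z by rewrite sqrtr_gt0.
have zE : z ^+ 2 = w by rewrite sqr_sqrtr // ltW.
have z1 : z < 1 by rewrite -sqrtr1 ltr_sqrt.
exists z, (w * (1 - 2 * (p * q) * e)); split.
- by rewrite z0.
- move=> n; have := @return_prob_gf (1 - e) r0 r1 n.
  by have -> : 1 - (1 - e) = e by ring.
- have -> : 1 - w * (1 - 2 * (p * q) * e) = w * (x + 2 * (p * q) * e).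
    by rewrite -[X in X - _]wE; ring.
  apply/andP; split; last by nra.
  have : 2^-1 <= w by nra.
  by nra.
- by nra.
(* As [z ^+ 2 = (1 + x)^-1], this is Bernoulli's inequality for [(1 + x) ^+ n], weakened by
   [p * q * e ^+ 2 <= x]. *)
- move=> n; rewrite exprAC zE /w exprVn ler_pdivrMr ?mul1r ?exprn_gt0 ?addr_gt0 //.
  elim: n => [|n IH]; first by rewrite mul0r addr0 expr0.
  rewrite -natr1.
  have n0 : 0 <= n%:R :> R by [].
  apply: le_trans (_ : (1 + x) * (1 + n%:R * (p * q * e ^+ 2)) <= _).
    have : 0 <= n%:R * (p * q * e ^+ 2) * x.
      by rewrite mulr_ge0 ?(ltW x0) // mulr_ge0 // mulr_ge0 ?(ltW b0) ?(ltW e20).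
    by nra.
  by rewrite [_ ^+ n.+1]exprS ler_wpM2l ?addr_ge0 ?(ltW x0) //.
Qed.

Lemma ler_sum_ord (u : nat -> R) m n : (forall k, 0 <= u k) -> (m <= n)%N ->
  \sum_(k < m) u k <= \sum_(k < n) u k.
Proof.
move=> u0 /subnKC <-; rewrite big_split_ord /= lerDl.
by apply: sumr_ge0.
Qed.

Lemma sum_return_prob_le1 n : \sum_(m < n) return_prob m <= 1.
Proof.
(* At [rho = 1] both [z] and [F] equal 1. *)
have /andP[+ _] := @return_prob_gf 1 ltr01 (lexx 1) n.
rewrite subrr expr0n /= !(mulr0, mul0r) addr0 subr0 invr1 sqrtr1 mulr1.
under eq_bigr do rewrite expr1n mul1r.
apply: le_trans; apply: ler_sum_ord => [k|]; [exact: return_prob_ge0 | lia].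
Qed.

End FirstReturn.

(** * Moments of the return time of the jump chain *)

Section ReturnMoments.
Context {R : realType} (p q : R).
Hypotheses (p0 : 0 < p) (q0 : 0 < q) (pq1 : p + q = 1).
Let f := return_prob p q.
Let f0 n : 0 <= f n. Proof. exact: return_prob_ge0. Qed.

Lemma exprn_lt_eps (z e : R) : 0 < z < 1 -> 0 < e ->
  exists n0, forall n, (n0 <= n)%N -> z ^+ n < e.
Proof.
move=> /andP[z0 z1] e0.
have /cvgrPdist_lt/(_ _ e0)[n0 _ h] : (fun n => z ^+ n) @ \oo --> (0 : R).
  by apply: cvg_expr; rewrite gtr0_norm.
exists n0 => n /h; rewrite sub0r normrN ger0_norm //.
by rewrite exprn_ge0 // ltW.
Qed.

(** Since [f] has mass at most 1, the sum is at most [1 - F] plus a remainder that is a power of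
    [z]. The terms are nonnegative, so the sum may be lengthened until that remainder is below any
    [d]. *)
Lemma return_prob_defect (e : R) : 0 < e <= 2^-1 -> exists2 z : R, 0 < z < 1 &
  (forall n, \sum_(m < n) f m * (1 - z ^+ m) <= e) /\
  (forall n, (1 + n%:R * (p * q * e ^+ 2)) * z ^+ n ^+ 2 <= 1).
Proof.
move=> he; have [z [F [zb gf /andP[_ Fe] _ hz]]] := return_prob_gf_eps p0 q0 pq1 he.
have [/ltW z0 /ltW z1] := andP zb.
exists z => //; split => // n; apply/ler_addgt0Pr => d d0.
have [n0 hn0] := exprn_lt_eps zb d0.
pose L := maxn n n0; have /andP[_ gL] := gf L.
have zL : z ^+ L.+1 < d by apply/hn0/leqW/leq_maxr.
apply: (@le_trans _ _ (\sum_(m < L.+2) f m * (1 - z ^+ m))).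
  apply: (@ler_sum_ord _ (fun m => f m * (1 - z ^+ m))); last exact: leqW (leqW (leq_maxl _ _)).
  by move=> k; rewrite mulr_ge0 // subr_ge0 exprn_ile1.
under eq_bigr do rewrite mulrBr mulr1 [X in _ - X]mulrC.
rewrite sumrB; have := sum_return_prob_le1 p0 q0 pq1 L.+2; rewrite -/f => ?.
by move: gL Fe zL; rewrite -/f; lra.
Qed.

(** Recurrence of the jump chain: the mass of [f] dominates its generating function, which tends to
    1 with [z]. *)
Lemma sum_return_prob_ge (d : R) : 0 < d ->
  exists n0, forall n, (n0 <= n)%N -> 1 - d <= \sum_(m < n) f m.
Proof.
move=> d0; pose e := Num.min 2^-1 (d / 2).
have he : 0 < e <= 2^-1 by rewrite /e lt_min ge_min lexx /= andbT; apply/andP; split; lra.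
have ed : e <= d / 2 by rewrite /e ge_min lexx orbT.
have [z [F [zb gf /andP[_ Fe] _ _]]] := return_prob_gf_eps p0 q0 pq1 he.
have [/ltW z0 /ltW z1] := andP zb.
have d20 : 0 < d / 2 by lra.
have [n0 hn0] := exprn_lt_eps zb d20.
exists n0.+2 => n hn; have /andP[_ gL] := gf n0.
have zL : z ^+ n0.+1 < d / 2 by apply: hn0.
apply: (@le_trans _ _ (\sum_(m < n0.+2) f m)); last exact: ler_sum_ord.
apply: (@le_trans _ _ (\sum_(m < n0.+2) z ^+ m * f m)).
  by move: gL Fe; rewrite -/f; lra.
by apply: ler_sum => i _; rewrite ler_piMl // exprn_ile1.
Qed.

(** The block of [m] of size about [4 ^ j] has weight about [y ^+ j], while its mass is controlled
    by a defect of at most [2^-1 ^+ j.+1]. The resulting geometric series has ratio [y / 2], which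
    is below 1 because [a < 2^-1]. *)
Lemma return_moment_bounded (a : R) : 0 < a < 2^-1 ->
  exists C, forall n, \sum_(m < n) f m * m%:R `^ a <= C.
Proof.
move=> /andP[a0 a2]; set y : R := 4 `^ a.
have y0 : 0 <= y by rewrite powR_ge0.
have y1 : 1 <= y by rewrite -(powRr0 4) ler_powR // ?ltW //; lra.
have y2 : y / 2 < 1.
  rewrite ltr_pdivrMr // mul1r /y.
  have -> : 2 = 4 `^ 2^-1 :> R.
    by rewrite powR12_sqrt // (_ : 4 = 2 ^+ 2) ?sqrtr_sqr ?ger0_norm // expr2 -natrM.
  by rewrite /powR gt_eqF // ltr_expR ltr_pM2r // ln_gt0 // ltr1n.
(* For [4 ^ j <= m < 4 ^ j.+1] the defect [1 - z j ^+ m] is bounded below, so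
   [m `^ a] is dominated by the sum over [j] of the [y ^+ j * (1 - z j ^+ m)]. *)
pose e (j : nat) : R := 2^-1 ^+ j.+1.
have he j : 0 < e j <= 2^-1.
  by rewrite exprn_gt0 // /e exprS ler_piMr // exprn_ile1 // invf_le1 // ler1n.
have /choice[z hz] : forall j, exists z : R, [/\ 0 < z < 1,
    forall n, \sum_(m < n) f m * (1 - z ^+ m) <= e j &
    forall n, (1 + n%:R * (p * q * e j ^+ 2)) * z ^+ n ^+ 2 <= 1].
  by move=> j; have [z z01 [z1 z2]] := return_prob_defect (he j); exists z.
have z0 j m : 0 <= 1 - z j ^+ m.
  by have [/andP[? ?] _ _] := hz j; rewrite subr_ge0 exprn_ile1 // ltW.
have b0 : 0 < p * q by rewrite mulr_gt0.
have b4 := pq_le_quarter pq1.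
pose k : R := p * q / 16.
have k0 : 0 < k by rewrite divr_gt0.
have key n m : (m < n)%N ->
    k * m%:R `^ a <= y * \sum_(j < n) y ^+ j * (1 - z j ^+ m).
  case: m => [_|m mn].
    rewrite powR0 ?gt_eqF // mulr0 mulr_ge0 // sumr_ge0 // => i _.
    by rewrite mulr_ge0 // exprn_ge0.
  pose j := trunc_log 4 m.+1.
  have /andP[j1 j2] : (4 ^ j <= m.+1 < 4 ^ j.+1)%N by exact: trunc_log_bounds.
  have jn : (j < n)%N.
    by apply: leq_ltn_trans mn; apply: leq_trans j1; apply/ltnW/ltn_expl.
  have hk : k <= 1 - z j ^+ m.+1.
    have [/andP[/ltW zj _] _ /(_ m.+1)] := hz j.
    have : 4^-1 <= m.+1%:R * e j ^+ 2.
      rewrite /e exprAC (_ : 2^-1 ^+ 2 = 4^-1 :> R); last by field.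
      rewrite exprVn ler_pdivlMr ?exprn_gt0 // exprS mulKf ?pnatr_eq0 //.
      by rewrite -natrX ler_nat.
    have := exprn_ge0 m.+1 zj; have := z0 j m.+1.
    rewrite [_ * (p * q * _)]mulrCA /k.
    move: (z j ^+ m.+1) (m.+1%:R * _) => u v u1 u0 v4 h.
    have {h} : (1 + p * q / 4) * u ^+ 2 <= 1.
      apply: le_trans h; rewrite ler_wpM2r ?sqr_ge0 // lerD2l ler_wpM2l //.
      exact: ltW.
    (* If [u ^+ 2 > 1/2], then [pq / 8 <= (pq / 4) u ^+ 2 <= 1 - u ^+ 2 <= 2 (1 - u)], whence the 16
       in [k]. Otherwise [u] stays away from 1 and [p * q <= 1/4] suffices. *)
    by case: (leP (u ^+ 2) 2^-1) => ? ?; nra.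
  rewrite (bigD1 (Ordinal jn)) //= mulrDr.
  apply: (@le_trans _ _ (y * (y ^+ j * k))); last first.
    rewrite -[X in X <= _]addr0 lerD ?ler_wpM2l ?exprn_ge0 // mulr_ge0 // sumr_ge0 // => i _.
    by rewrite mulr_ge0 // exprn_ge0.
  rewrite mulrA -exprS mulrC ler_wpM2r ?(ltW k0) //.
  rewrite /y -powR_mulrn ?powR_ge0 // powRAC powR_mulrn //.
  by rewrite ge0_ler_powR ?nnegrE ?exprn_ge0 // ?(ltW a0) // -natrX ler_nat ltnW.
exists (k^-1 * (y * (2^-1 * (1 - y / 2)^-1))) => n.
rewrite mulrC ler_pdivlMr // mulrC mulr_sumr.
apply: (@le_trans _ _ (\sum_(m < n) f m * (y * \sum_(j < n) y ^+ j * (1 - z j ^+ m)))).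
  by apply: ler_sum => i _; rewrite mulrCA ler_wpM2l // key.
rewrite (_ : \sum_(m < n) _ = y * \sum_(j < n) y ^+ j * \sum_(m < n) f m * (1 - z j ^+ m)); last first.
  rewrite mulr_sumr; under eq_bigr do rewrite !mulr_sumr.
  rewrite exchange_big; apply: eq_bigr => j _ /=.
  by rewrite !mulr_sumr; apply: eq_bigr => i _; ring.
rewrite ler_wpM2l // -(ler_pM2r (_ : 0 < 1 - y / 2)) ?subr_gt0 //.
rewrite divfK ?gt_eqF ?subr_gt0 //.
apply: (@le_trans _ _ (2^-1 * ((1 - y / 2) * \sum_(j < n) (y / 2) ^+ j))).
  rewrite mulrC mulrCA ler_wpM2l ?subr_ge0 ?(ltW y2) // mulr_sumr.
  apply: ler_sum => j _.
  rewrite exprMn mulrCA -exprS ler_wpM2l ?exprn_ge0 //.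
  by have [_ /(_ n)] := hz j.
have := subrX1 (y / 2) n.
have : 0 <= (y / 2) ^+ n by rewrite exprn_ge0 // divr_ge0.
by move: (\sum_(i < n) _) ((y / 2) ^+ n) => S t; lra.
Qed.

Lemma return_sqrt_moment_unbounded C :
  ~ forall n, \sum_(m < n) f m * Num.sqrt m%:R <= C.
Proof.
move=> hC; pose S n := \sum_(m < n) f m * Num.sqrt m%:R.
have b0 : 0 < p * q by rewrite mulr_gt0.
pose d := p * q / 8; have d0 : 0 < d by rewrite divr_gt0.
(* [S K] is within [d] of the supremum of the partial sums, so all terms beyond [K] together add at
   most [d]. *)
have [K hK] : exists K, forall n, S n <= S K + d.
  have hS : has_sup (range S).
    by split; [exists (S 0%N), 0%N | exists C => _ [n _ <-]; exact: hC].
  have [_ [K _ <-] hK] := sup_adherent d0 hS.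
  exists K => n; rewrite -lerBlDr; apply: le_trans (ltW hK).
  by rewrite lerD2r; apply: ub_le_sup; [case: hS | exists n].
(* [e] is chosen after [K], so that the terms below [K], of total at most [K * e ^+ 2], are small
   compared with [e]. *)
pose e : R := Num.min 2^-1 (p * q / (16 * K.+1%:R)).
have he : 0 < e <= 2^-1.
  by rewrite /e lt_min ge_min lexx /= andbT; apply/andP; split => //; rewrite divr_gt0 // mulr_gt0.
have eK : K%:R * e <= p * q / 16.
  apply: (@le_trans _ _ (K.+1%:R * (p * q / (16 * K.+1%:R)))).
    by rewrite ler_pM // ?ler_nat // ?ge_min ?lexx ?orbT //; case/andP: he => /ltW.
  rewrite le_eqVlt; apply/orP; left; apply/eqP.
  have : K.+1%:R != 0 :> R by rewrite pnatr_eq0.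
  by move: (K.+1%:R) => x x0; field.
have [z [F [zb gf /andP[Fe _] ze _]]] := return_prob_gf_eps p0 q0 pq1 he.
have [e0 e2] := andP he; have [/ltW z0 /ltW z1] := andP zb.
have ded : 0 < d * e by rewrite mulr_gt0.
have [n0 hn0] := sum_return_prob_ge ded.
pose L := maxn K n0; have /andP[gL _] := gf L.
have {}hn0 := hn0 L.+2 (leqW (leqW (leq_maxr _ _))).
have KL : (K <= L.+2)%N by exact: leqW (leqW (leq_maxl _ _)).
have min1 m : 1 - z ^+ m <= m%:R * e ^+ 2.
  apply: (@le_trans _ _ (m%:R * (1 - z))); last by rewrite ler_wpM2l.
  elim: m => [|m IH]; first by rewrite expr0 subrr mul0r.
  rewrite exprS -natr1; have := exprn_ile1 m z0 z1; have := exprn_ge0 m z0.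
  by move: IH; move: (z ^+ m) (m%:R) => u v; nra.
(* With [t] the square root of [m]: if [t * e <= 1] then [m * e ^+ 2 = (t * e) ^+ 2 <= t * e], and
   otherwise the left side is at most 1. *)
have min2 m : 1 - z ^+ m <= Num.sqrt m%:R * e.
  set t := Num.sqrt _; have t0 : 0 <= t by rewrite sqrtr_ge0.
  have tE : t ^+ 2 = m%:R by rewrite sqr_sqrtr.
  have := min1 m; rewrite -tE -exprMn.
  have := exprn_ge0 m z0; have : 0 <= t * e by rewrite mulr_ge0 // ltW.
  by case: (leP (t * e) 1) => ? ? ? ?; nra.
have split_sum : \sum_(m < L.+2) f m * (1 - z ^+ m) <= K%:R * e ^+ 2 + e * d.
  have -> : L.+2 = (K + (L.+2 - K))%N by rewrite subnKC.
  rewrite big_split_ord /=; apply: lerD.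
    apply: (@le_trans _ _ (\sum_(m < K) f m * (K%:R * e ^+ 2))).
      apply: ler_sum => i _; rewrite ler_wpM2l // (le_trans (min1 _)) //.
      by rewrite ler_wpM2r ?sqr_ge0 // ler_nat ltnW.
    rewrite -mulr_suml ler_piMl ?mulr_ge0 ?(ltW e0) //.
    exact: (sum_return_prob_le1 p0 q0 pq1 K).
  apply: (@le_trans _ _ (e * \sum_(i < L.+2 - K) f (K + i) * Num.sqrt (K + i)%:R)).
    rewrite mulr_sumr; apply: ler_sum => i _.
    by rewrite mulrCA ler_wpM2l // mulrC min2.
  rewrite ler_wpM2l ?(ltW e0) //.
  have := hK (K + (L.+2 - K))%N; rewrite /S big_split_ord /=.
  by rewrite lerD2l.
move: split_sum; under eq_bigr do rewrite mulrBr mulr1 [X in _ - X]mulrC.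
rewrite sumrB.
move: gL hn0; rewrite -/f; set A := \sum_(m < _) _; set B := \sum_(m < _) _.
move=> gL hn0 sAB.
(* The left side bounds [1 - F] from below. The right side is at most [(1/8 + 1/16 + 1/8) pq e],
   that is [5/16 pq e], which is too small. *)
have : p * q * e / 2 <= d * e + (K%:R * e ^+ 2 + e * d) by lra.
have : K%:R * e ^+ 2 <= e * (p * q / 16).
  by rewrite expr2 mulrA mulrC ler_wpM2l // ltW.
have : 0 < p * q * e by rewrite mulr_gt0.
by rewrite /d; lra.
Qed.

End ReturnMoments.

(** * Trajectories *)

Section Path.
Context {R : realType} (x : R -> int).
Hypothesis rcx : right_continuous_path x.

(** Lets the infima that define jump and return times be tested on rational times, hence by
    countable unions of events. *)
Lemma right_continuous_rat t u : 0 <= t -> t < u ->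
  exists s : rat, t < ratr s < u /\ x (ratr s) = x t.
Proof.
move=> t0 tu; have [e e0 he] := rcx t0.
have : t < Num.min u (t + e) by rewrite lt_min tu ltrDl.
move=> /rat_in_itvoo[s]; rewrite in_itv /= lt_min => /and3P[ts su se].
by exists s; rewrite ts su he // se ltW.
Qed.

Lemma jump_time_ge0 n : (0 <= jump_time x n)%E.
Proof.
elim: n => [|n IH] //=; apply: le_ereal_inf_tmp => _ [t [+ _] <-].
exact: le_trans.
Qed.

Lemma jump_timeS_ltP n (t : R) : (jump_time x n.+1 < t%:E)%E <->
  exists s : rat, [/\ ratr s < t, (jump_time x n <= (ratr s)%:E)%E &
    x (ratr s) <> x (fine (jump_time x n))].
Proof.
split=> [/ereal_inf_lt[_ [u [nu xu] <-]]|[s [st ns xs]]].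
  rewrite lte_fin => ut.
  have u0 : 0 <= u by rewrite -lee_fin (le_trans (jump_time_ge0 n)).
  have [s [/andP[us st] xs]] := right_continuous_rat u0 ut.
  exists s; rewrite st xs; split => //.
  by apply: le_trans nu _; rewrite lee_fin ltW.
apply: (@le_lt_trans _ _ (ratr s)%:E); last by rewrite lte_fin.
by apply: ereal_inf_lbound; exists (ratr s).
Qed.

Lemma jump_chain_fin n : jump_time x n \is a fin_num ->
  jump_chain x n = x (fine (jump_time x n)).
Proof. by case: n => //= n; case: ereal_inf. Qed.

Lemma path_between_jumps n t : (jump_time x n <= t%:E)%E ->
  (t%:E < jump_time x n.+1)%E -> x t = jump_chain x n.
Proof.
move=> nt tS; rewrite jump_chain_fin; last first.
  by rewrite ge0_fin_numE ?jump_time_ge0 // (le_lt_trans nt) ?ltry.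
apply: contrapT => xt; move: tS; rewrite ltNge => /negP; apply.
by apply: ereal_inf_lbound; exists t.
Qed.

Lemma jump_time_lt n : (jump_time x n < +oo)%E ->
  (jump_time x n < jump_time x n.+1)%E.
Proof.
move=> noo; have n0 := jump_time_ge0 n.
have : jump_time x n \is a fin_num by rewrite ge0_fin_numE.
move: n0 noo => /=; case: (jump_time x n) => //= v v0 _ _.
have [e e0 he] := rcx v0.
apply: (@lt_le_trans _ _ (v + e)%:E); first by rewrite lte_fin ltrDl.
apply: le_ereal_inf_tmp => _ [t [+ xt] <-]; rewrite !lee_fin => vt.
by rewrite leNgt; apply/negP => te; apply: xt; apply: he; rewrite vt te.
Qed.

Lemma jump_time_le n : (jump_time x n <= jump_time x n.+1)%E.
Proof.
have [noo|] := ltP (jump_time x n) +oo%E; first exact/ltW/jump_time_lt.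
by rewrite leye_eq => /eqP /= ->; apply: le_ereal_inf_tmp => _ [t [+ _] <-].
Qed.

Lemma jump_time_homo m n : (m <= n)%N -> (jump_time x m <= jump_time x n)%E.
Proof.
move=> /subnKC <-; elim: (n - m)%N => [|k IH]; first by rewrite addn0.
by rewrite addnS; apply: le_trans IH (jump_time_le _).
Qed.

Lemma jump_time_lt_trans m n : (m < n)%N -> (jump_time x m < +oo)%E ->
  (jump_time x m < jump_time x n)%E.
Proof.
by move=> mn /jump_time_lt m1; apply: lt_le_trans m1 (jump_time_homo mn).
Qed.

Lemma holding_time_gt0 n : (0 < holding_time x n)%E.
Proof.
rewrite /holding_time; have := @jump_time_lt n; have := jump_time_ge0 n.
case: (jump_time x n) => // v v0 /(_ (ltry v)).
by rewrite -sube_gt0.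
Qed.

(** Separating the case of an infinite jump time leaves a plain difference of jump times, whose
    measurability follows from theirs. *)
Lemma holding_time_gtP n (t : R) : (t%:E < holding_time x n)%E <->
  jump_time x n = +oo%E \/ (t%:E < jump_time x n.+1 - jump_time x n)%E.
Proof.
rewrite /holding_time; have := jump_time_ge0 n.
case: (jump_time x n) => [v| |] // _.
- by split => [|[]] //; right.
- by split => // _; [left | rewrite ltry].
Qed.

Lemma jump_time_sum n : jump_time x n = (\sum_(k < n) holding_time x k)%E.
Proof.
elim: n => [|n IH]; first by rewrite big_ord0.
rewrite big_ord_recr -IH [holding_time x _]/holding_time [nat_of_ord _]/=.
have := jump_time_ge0 n; have := jump_time_le n.
case: (jump_time x n) => [v| |] //.
- by move=> _ _; rewrite [RHS]addeC subeK.
- by rewrite leye_eq => /eqP ->.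
Qed.

(** A candidate time is pushed past one holding interval after another: on the interval after the
    [k]-th jump the path is constantly [jump_chain x k], which differs from [i]. *)
Lemma return_time_ge n i : (0 < n)%N ->
  (forall k, (0 < k < n)%N -> jump_chain x k <> i) ->
  (jump_time x n <= return_time i x)%E.
Proof.
move=> n0 hn; apply: le_ereal_inf_tmp => _ [t [t1 xt] <-].
elim: n n0 hn => // -[_ _ _|n IH _ hn]; first exact: ltW.
have {}IH : (jump_time x n.+1 <= t%:E)%E.
  by apply: IH => // k /andP[k0 kn]; apply: hn; rewrite k0 ltnW.
rewrite leNgt; apply/negP => tn; apply: (hn n.+1); first by rewrite ltnSn.
by rewrite -xt; apply/esym/path_between_jumps.
Qed.

(** With [1 < n], a finite [n]-th jump time lies strictly after the first one and is itself a
    candidate in the infimum. *)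
Lemma return_time_le n i : (1 < n)%N -> jump_chain x n = i ->
  (return_time i x <= jump_time x n)%E.
Proof.
move=> n1 xn; have [noo|] := ltP (jump_time x n) +oo%E; last first.
  by rewrite leye_eq => /eqP ->; rewrite leey.
have nfin : jump_time x n \is a fin_num by rewrite ge0_fin_numE ?jump_time_ge0.
apply: ereal_inf_lbound; exists (fine (jump_time x n)); last by rewrite fineK.
split; last by rewrite -jump_chain_fin.
rewrite fineK //; apply: jump_time_lt_trans => //.
exact: le_lt_trans (jump_time_homo (ltnW n1)) noo.
Qed.

Lemma return_time_ltP i (t : R) : (return_time i x < t%:E)%E <->
  exists s : rat, [/\ ratr s < t, (jump_time x 1 < (ratr s)%:E)%E &
    x (ratr s) = i].
Proof.
split=> [/ereal_inf_lt[_ [u [nu xu] <-]]|[s [st ns xs]]].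
  rewrite lte_fin => ut.
  have u0 : 0 <= u by rewrite -lee_fin (le_trans (jump_time_ge0 1)) // ltW.
  have [s [/andP[us st] xs]] := right_continuous_rat u0 ut.
  exists s; rewrite st xs; split => //.
  by apply: lt_le_trans nu _; rewrite lee_fin ltW.
apply: (@le_lt_trans _ _ (ratr s)%:E); last by rewrite lte_fin.
by apply: ereal_inf_lbound; exists (ratr s).
Qed.

Lemma return_time_ge0 i : (0 <= return_time i x)%E.
Proof.
apply: le_ereal_inf_tmp => _ [t [t1 _] <-].
exact: le_trans (jump_time_ge0 1) (ltW t1).
Qed.

(* A description of [x t] by countably many conditions that stays measurable
   when [t] is replaced by a random time. *)
Lemma path_at_ratP t i : 0 <= t -> x t = i <->
  exists s : rat, t < ratr s /\
    forall u : rat, u < s -> t < ratr u -> x (ratr u) = i.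
Proof.
move=> t0; split=> [<-|[s [ts hs]]].
  have [e e0 he] := rcx t0.
  have /rat_in_itvoo[s] : t < t + e by rewrite ltrDl.
  rewrite in_itv /= => /andP[ts se]; exists s; split => // u us tu.
  by apply: he; rewrite (ltW tu) (lt_trans _ se) ?ltr_rat.
have [u [/andP[tu us] <-]] := right_continuous_rat t0 ts.
by apply: hs => //; rewrite -(ltr_rat R).
Qed.

End Path.

(** * Measurability *)

Lemma emeasurable_fun_ltP {d} {T : measurableType d} {R : realType}
    (f : T -> \bar R) :
  (forall t : R, measurable [set w | (f w < t%:E)%E]) -> measurable_fun setT f.
Proof.
move=> hf; apply: (measurability _ (ErealGenInftyO.measurableE R)).
move=> _ [_ [t ->] <-]; rewrite setTI.
rewrite (_ : f @^-1` _ = [set w | (f w < t%:E)%E]) //.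
Qed.

Section PathMeasurability.
Context {d} {T : measurableType d} {R : realType} (X : R -> T -> int).
Hypothesis mX : forall t, 0 <= t -> forall i : int, measurable [set w | X t w = i].
Hypothesis rcX : forall w, right_continuous_path (X^~ w).

Let eta n w := jump_time (X^~ w) n.
Let Y n w := jump_chain (X^~ w) n.

Let measurable_neq t n : 0 <= t -> (forall i, measurable [set w | Y n w = i]) ->
  measurable [set w | X t w <> Y n w].
Proof.
move=> t0 mY.
rewrite (_ : [set w | _] = \bigcup_i ([set w | X t w = i] `\` [set w | Y n w = i])).
  apply: countable_bigcupT_measurable => [|i]; first exact: countableP.
  by apply: measurableD; [exact: mX|exact: mY].
apply/seteqP; split => w /= => [h|[i _ [/= -> h] /esym]//].
by exists (X t w) => //; split => // /esym.
Qed.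

(** The two claims are proved together: jump time [n + 1] is detected by comparing the path with
    [Y n], and [Y n.+1] is the path read at that random time. *)
Let measurable_jumps n :
  measurable_fun setT (eta n) /\ forall i, measurable [set w | Y n w = i].
Proof.
elim: n => [|n [meta mY]].
  by split => [|i]; [exact: measurable_cst|exact: mX].
have metaS : measurable_fun setT (eta n.+1).
  apply: emeasurable_fun_ltP => t.
  pose A (s : rat) := if (ratr s < t) && (0 <= ratr s :> R)
    then [set w | (eta n w <= (ratr s)%:E)%E] `&` [set w | X (ratr s) w <> Y n w]
    else set0.
  rewrite (_ : [set w | _] = \bigcup_s A s).
    apply: bigcupT_measurable_rat => s; rewrite /A; case: ifPn => // /andP[_ s0].
    apply: measurableI; last exact: measurable_neq.
    by rewrite -[X in measurable X]setTI; exact: emeasurable_fun_infty_c.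
  apply/seteqP; split => w /=.
    move=> /(jump_timeS_ltP (rcX w))[s [st ns xs]]; exists s => //.
    rewrite /A st -lee_fin (le_trans (jump_time_ge0 _ n) ns) /=; split => //=.
    rewrite /Y jump_chain_fin // ge0_fin_numE ?jump_time_ge0 //.
    exact: le_lt_trans ns (ltry _).
  move=> [s _]; rewrite /A; case: ifPn => // /andP[st _] [/= ns xs].
  apply/(jump_timeS_ltP (rcX w)); exists s; split => // xE.
  apply: xs; rewrite xE /Y jump_chain_fin // ge0_fin_numE ?jump_time_ge0 //.
  exact: le_lt_trans ns (ltry _).
split => // i.
(* [path_at_ratP] at the random time [eta n.+1 w]: for some rational [s] beyond it, every rational
   [u < s] either does not exceed it or has [X (ratr u) w = i]. When that time is infinite, [Y]
   keeps its previous value. *)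
pose B (s u : rat) := if (u < s) && (0 <= ratr u :> R)
    then [set w | ((ratr u)%:E <= eta n.+1 w)%E] `|` [set w | X (ratr u) w = i]
    else setT.
rewrite (_ : [set w | _] = ([set w | (eta n.+1 w = +oo)%E] `&` [set w | Y n w = i]) `|`
   \bigcup_s ([set w | (eta n.+1 w < (ratr s)%:E)%E] `&` \bigcap_u B s u)).
  apply: measurableU.
    apply: measurableI => //.
    by rewrite -[X in measurable X]setTI; exact: (metaS _ [set +oo%E]).
  apply: bigcupT_measurable_rat => s; apply: measurableI.
    by rewrite -[X in measurable X]setTI; exact: emeasurable_fun_infty_o.
  rewrite -[X in measurable X]setCK setC_bigcap; apply: measurableC.
  apply: bigcupT_measurable_rat => u; apply: measurableC; rewrite /B.
  case: ifPn => // /andP[_ u0]; apply: measurableU; last exact: mX.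
  by rewrite -[X in measurable X]setTI; exact: emeasurable_fun_c_infty.
have S0 w : (0 <= eta n.+1 w)%E by exact: jump_time_ge0.
apply/seteqP; split => w /=.
- rewrite /Y => Yi; have := S0 w; have := Yi; rewrite [jump_chain _ _]/=.
  rewrite -/(jump_time (X^~ w) n.+1) -/(eta n.+1 w).
  case E: (eta n.+1 w) => [v| |] // xv v0; last by left.
  right; move: v0; rewrite lee_fin => v0.
  have [s [vs hs]] := (path_at_ratP (rcX w) i v0).1 xv.
  exists s => //; split => /= [|u _]; first by rewrite E lte_fin.
  rewrite /B; case: ifPn => // /andP[us _] /=.
  by rewrite E lee_fin; case: (leP (ratr u) v) => ?; [left|right; exact: hs].
- have := S0 w; rewrite /Y [jump_chain _ n.+1]/=.
  rewrite -/(jump_time (X^~ w) n.+1) -/(eta n.+1 w).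
  move=> e0 [[-> //]|[s _ [/= es hB]]].
  move: e0 es hB; rewrite /B; case E: (eta n.+1 w) => [v| |] // v0.
  move: v0; rewrite lee_fin lte_fin => v0 vs hB.
  apply/(path_at_ratP (rcX w)) => //; exists s; split => // u us vu.
  have := hB u I; rewrite us (ltW (le_lt_trans v0 vu)) /=.
  by case=> //; rewrite E lee_fin leNgt vu.
Qed.

Lemma measurable_jump_time n : measurable_fun setT (fun w => jump_time (X^~ w) n).
Proof. by have [] := measurable_jumps n. Qed.

Lemma measurable_jump_chain n i : measurable [set w | jump_chain (X^~ w) n = i].
Proof. by have [_] := measurable_jumps n. Qed.

Lemma measurable_holding_time_gt n (t : R) :
  measurable [set w | (t%:E < holding_time (X^~ w) n)%E].
Proof.
rewrite (_ : [set w | _] = [set w | (jump_time (X^~ w) n = +oo)%E] `|`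
   [set w | (t%:E < jump_time (X^~ w) n.+1 - jump_time (X^~ w) n)%E]).
  apply: measurableU; rewrite -[X in measurable X]setTI.
    by have h := measurable_jump_time n; apply: (h _ [set +oo%E]).
  have mB := emeasurable_funB (measurable_jump_time n.+1) (measurable_jump_time n).
  exact: (emeasurable_fun_o_infty _ mB).
by apply/seteqP; split => w /= /holding_time_gtP.
Qed.

Lemma measurable_return_time i : measurable_fun setT (fun w => return_time i (X^~ w)).
Proof.
apply: emeasurable_fun_ltP => t.
pose A (s : rat) := if (ratr s < t) && (0 <= ratr s :> R)
  then [set w | (jump_time (X^~ w) 1 < (ratr s)%:E)%E] `&` [set w | X (ratr s) w = i]
  else set0.
rewrite (_ : [set w | _] = \bigcup_s A s).
  apply: bigcupT_measurable_rat => s; rewrite /A; case: ifPn => // /andP[_ s0].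
  apply: measurableI; last exact: mX.
  rewrite -[X in measurable X]setTI; apply: emeasurable_fun_infty_o => //.
  exact: measurable_jump_time.
apply/seteqP; split => w /=.
  move=> /(return_time_ltP (rcX w))[s [st ns xs]]; exists s => //.
  by rewrite /A st -lee_fin (le_trans (jump_time_ge0 _ 1) (ltW ns)).
move=> [s _]; rewrite /A; case: ifPn => // /andP[st _] [/= ns xs].
by apply/(return_time_ltP (rcX w)); exists s.
Qed.

End PathMeasurability.

(** * Law of the excursions *)

Lemma measurable_forall_nat {d} {T : measurableType d} (b : pred nat)
    (F : nat -> T -> Prop) : (forall j, measurable [set w | F j w]) ->
  measurable [set w | forall j, b j -> F j w].
Proof.
move=> mF; rewrite (_ : [set w | _] =
    \bigcap_j (if b j then [set w | F j w] else setT)).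
  by apply: bigcapT_measurable => j; case: ifP.
apply/seteqP; split => w /= h j.
  by move=> _; case: ifP => // /h.
by move=> bj; have := h j I; rewrite bj.
Qed.

Section Excursions.
Context {R : realType} {d : measure_display} {T : measurableType d}.
Variables (P : probability T R) (r s : R).
Hypotheses (hr : 0 < r) (hs : 0 < s).
Let Q := birth_death_Q (alternating_birth r s) (alternating_death r s).
Let c := r + s.
Let p := r / c.
Let q := s / c.
Variable X : R -> T -> int.
Hypothesis hX : ctmc P (fun i : int => (i == 0)%:R) Q X.

Let Y n w := jump_chain (X^~ w) n.
Let c0 : 0 < c. Proof. exact: addr_gt0. Qed.

(** The rates [r] and [s] only swap roles with parity, so holding times carry no information on the
    position. *)
Lemma alternating_exit_rate i : exit_rate Q i = c.
Proof.
rewrite /exit_rate /Q /birth_death_Q eqxx.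
have -> : (i == i + 1) = false by lia.
have -> : (i == i - 1) = false by lia.
by rewrite opprK /alternating_birth /alternating_death; case: ifP => _; rewrite /c 1?addrC.
Qed.

Lemma jump_matrix_up i : jump_matrix Q i (i + 1) = step_up p q i.
Proof.
rewrite /jump_matrix alternating_exit_rate gt_eqF // /Q /birth_death_Q eqxx.
have -> : (i == i + 1) = false by lia.
by rewrite /alternating_birth /step_up; case: ifP.
Qed.

Lemma jump_matrix_down i : jump_matrix Q i (i - 1) = step_down p q i.
Proof.
rewrite /jump_matrix alternating_exit_rate gt_eqF // /Q /birth_death_Q eqxx.
have -> : (i == i - 1) = false by lia.
have -> : (i - 1 == i + 1) = false by lia.
by rewrite /alternating_death /step_down; case: ifP.
Qed.

Let pq1 : p + q = 1. Proof. by rewrite /p /q -mulrDl divff // gt_eqF. Qed.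

Let mY n i : measurable [set w | Y n w = i].
Proof.
exact: measurable_jump_chain (ctmc_measurable hX) (ctmc_right_continuous hX) n i.
Qed.

Let mS n t : measurable [set w | (t%:E < holding_time (X^~ w) n)%E].
Proof.
exact: measurable_holding_time_gt (ctmc_measurable hX) (ctmc_right_continuous hX) n t.
Qed.

Definition follows m (i : nat -> int) : set T :=
  [set w | forall k, (k <= m)%N -> jump_chain (X^~ w) k = i k].

Definition path_weight m (i : nat -> int) : R :=
  (i 0%N == 0)%:R * \prod_(k < m) jump_matrix Q (i k) (i k.+1).

(** A path is an infinite sequence of which only the entries up to [m] are read; lengthening it
    overwrites entry [m + 1]. *)
Definition extend (i : nat -> int) m y k : int := if k == m.+1 then y else i k.

Lemma measurable_follows m i : measurable (follows m i).
Proof. by apply: (@measurable_forall_nat _ _ (fun k => (k <= m)%N)) => j; exact: mY. Qed.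

Lemma follows_extend m i y :
  follows m.+1 (extend i m y) = follows m i `&` [set w | Y m.+1 w = y].
Proof.
apply/seteqP; split => w /=.
  move=> h; split => [k km|]; rewrite ?/Y h // ?leqW // /extend ?eqxx //.
  by rewrite ltn_eqF.
move=> [h1 h2] k; rewrite /extend; case: eqP => [->//|/eqP kn].
by rewrite leq_eqVlt (negbTE kn) /=; exact: h1.
Qed.

Lemma path_weight_extend m i y :
  path_weight m.+1 (extend i m y) = path_weight m i * jump_matrix Q (i m) y.
Proof.
rewrite /path_weight big_ord_recr /= mulrA /extend eqxx (ltn_eqF (ltnSn m)).
congr (_ * _ * _); apply: eq_bigr => k _.
by rewrite (ltn_eqF (leqW (ltn_ord k))) eqSS (ltn_eqF (ltn_ord k)).
Qed.

Lemma prob_follows m i : P (follows m i) = (path_weight m i)%:E.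
Proof. exact: (ctmc_jump_chain hX). Qed.

(* Only steps of size 1 have positive weight, so no countable sum is needed. *)
Lemma prob_split_step m i B : measurable B -> B `<=` follows m i ->
  P B = (P (B `&` [set w | Y m.+1 w = (i m + 1)%R])
       + P (B `&` [set w | Y m.+1 w = (i m - 1)%R]))%E.
Proof.
move=> mB Bf.
set U := [set w | _ = (_ + 1)%R]; set D := [set w | _ = (_ - 1)%R].
have mU : measurable U by exact: mY.
have mD : measurable D by exact: mY.
have split_eq A : measurable A -> P A = (P (A `&` U) + P (A `&` D) + P ((A `\` U) `\` D))%E.
  move=> mA; rewrite (measureDI _ mA mU) addeC -addeA; congr (_ + _)%E.
  rewrite (measureDI _ (measurableD mA mU) mD) addeC; congr (P _ + _)%E.
  congr (P _); apply/seteqP; split => w /=; first by move=> [[]].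
  by move=> [Aw Dw]; split => //; split => //; rewrite /U /= Dw; lia.
have mF := measurable_follows m i.
(* The up and down probabilities sum to 1, so these two steps exhaust the mass of [follows m i]; the
   rest is null, and so is its part inside [B]. *)
have F0 : P ((follows m i `\` U) `\` D) = 0%E.
  have := split_eq _ mF; rewrite -!follows_extend !prob_follows !path_weight_extend.
  rewrite jump_matrix_up jump_matrix_down -EFinD -mulrDr step_sum // mulr1.
  have mN : measurable ((follows m i `\` U) `\` D) by do 2 apply: measurableD => //.
  rewrite -(fineK (fin_num_measure P _ mN)) -EFinD => -[h].
  by congr (_%:E); lra.
rewrite {1}(split_eq _ mB) [X in (_ + X)%E](_ : _ = 0%E) ?adde0 //.
apply/eqP; rewrite eq_le measure_ge0 andbT -F0.
rewrite le_measure ?inE //; last by move=> w [[/Bf]].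
- by do 2 apply: measurableD => //.
- by do 2 apply: measurableD => //.
Qed.

(** The path is prescribed up to step [m] and then first reaches 0 after [n] more steps. A single
    holding time is constrained, as only first moments of holding times will be used. *)
Definition excursion m n i k t : set T :=
  [set w | [/\ follows m i w, forall j, (m <= j < m + n)%N -> Y j w <> 0,
     Y (m + n) w = 0 & (t%:E < holding_time (X^~ w) k)%E]].

Lemma measurable_excursion m n i k t : measurable (excursion m n i k t).
Proof.
rewrite (_ : excursion _ _ _ _ _ = follows m i `&`
   [set w | forall j, (m <= j < m + n)%N -> Y j w <> 0] `&`
   [set w | Y (m + n) w = 0] `&` [set w | (t%:E < holding_time (X^~ w) k)%E]).
  apply: measurableI => //; apply: measurableI => //.
  apply: measurableI; first exact: measurable_follows.
  apply: measurable_forall_nat => j.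
  rewrite (_ : [set w | _] = ~` [set w | Y j w = 0]) //.
  exact: measurableC.
by apply/seteqP; split => w /= [] // [[? ?] ?].
Qed.

Lemma excursion_extend m n i k t y : i m != 0 ->
  excursion m n.+1 i k t `&` [set w | Y m.+1 w = y] =
  excursion m.+1 n (extend i m y) k t.
Proof.
move=> im; rewrite /excursion follows_extend addnS addSn.
apply/seteqP; split => w /= -[].
  move=> [fw Yw Y0 tS] Yy; split => // j /andP[mj jn]; apply: Yw.
  by rewrite (ltnW mj).
move=> [fw Yy] Yw Y0 tS; split => //; split => // j /andP[mj jn].
have [<-|jm] := eqVneq m j; first by rewrite /Y fw //; exact/eqP.
by apply: Yw; rewrite jn andbT ltn_neqAle jm.
Qed.

(** The induction follows the recursion of [hit_prob], lengthening the prescribed path by one step.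
    At [n = 0] the path is fully prescribed up to [m >= k], so the law of the holding times
    applies. *)
Lemma prob_excursion m n i k t : 0 <= t -> (k <= m + n)%N ->
  P (excursion m n i k t) =
  (path_weight m i * hit_prob p q n (i m) * expR (- (c * t)))%:E.
Proof.
move=> t0; elim: n m i => [|n IH] m i kmn.
  rewrite addn0 in kmn.
  have [im0|im0] := eqVneq (i m) 0; last first.
    rewrite /= (negbTE im0) mulr0 mul0r (_ : excursion _ _ _ _ _ = set0) ?measure0 //.
    apply/seteqP; split => w //= [fw _]; rewrite addn0 /Y fw // => im.
    by rewrite im eqxx in im0.
  (* Threshold 0 at the other indices imposes nothing, holding times being positive. *)
  pose tt j := if j == k then t else 0.
  rewrite (_ : excursion _ _ _ _ _ = [set w | forall j, (j < m.+1)%N ->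
      Y j w = i j /\ ((tt j)%:E < holding_time (X^~ w) j)%E]).
    rewrite (ctmc_holding_times hX) => [|j]; last by rewrite /tt; case: ifP.
    rewrite [X in (X * _)%E](prob_follows m i) -EFinM im0 /= mulr1; congr (_ * _)%:E.
    rewrite (bigD1 (Ordinal (kmn : (k < m.+1)%N))) //= alternating_exit_rate /tt eqxx.
    rewrite big1 ?mulr1 // => j jk; rewrite ifF ?mulr0 ?oppr0 ?expR0 //.
    by apply: contraNF jk => /eqP jk; apply/eqP/val_inj.
  apply/seteqP; split => w /=.
    move=> [fw _ _ tS] j jm; split; first exact: fw.
    rewrite /tt; case: eqP => [->//|_].
    exact: holding_time_gt0 (ctmc_right_continuous hX w) j.
  move=> h; rewrite /excursion /= addn0; split.
  - by move=> j jm; have [] := h j jm.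
  - by move=> j; case: ltngtP => // _; rewrite ?andbF // => /andP[].
  - by have [-> _] := h m (ltnSn m).
  - by have [_] := h k kmn; rewrite /tt eqxx.
have [im0|im0] := eqVneq (i m) 0.
  rewrite /= im0 eqxx mulr0 mul0r (_ : excursion _ _ _ _ _ = set0) ?measure0 //.
  apply/seteqP; split => w //= [fw /(_ m) h _ _]; apply: h; last by rewrite /Y fw.
  by rewrite leqnn addnS ltnS leq_addr.
rewrite (@prob_split_step m i); first last.
- by move=> w [].
- exact: measurable_excursion.
rewrite !excursion_extend // !IH ?addSnnS // !path_weight_extend.
rewrite jump_matrix_up jump_matrix_down /extend eqxx /= (negbTE im0) -EFinD.
by congr (_%:E); ring.
Qed.

Definition first_return n : set T :=
  [set w | [/\ Y 0%N w = 0, forall j, (0 < j < n)%N -> Y j w <> 0 & Y n w = 0]].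

Lemma measurable_first_return n : measurable (first_return n).
Proof.
rewrite (_ : first_return n = [set w | Y 0%N w = 0] `&`
   [set w | forall j, (0 < j < n)%N -> Y j w <> 0] `&` [set w | Y n w = 0]).
  apply: measurableI => //; apply: measurableI => //.
  apply: measurable_forall_nat => j.
  rewrite (_ : [set w | _] = ~` [set w | Y j w = 0]) //.
  exact: measurableC.
by apply/seteqP; split => w /= [] // [].
Qed.

Lemma prob_first_return_holding n k t : (0 < n)%N -> 0 <= t -> (k <= n)%N ->
  P (first_return n `&` [set w | (t%:E < holding_time (X^~ w) k)%E]) =
  (return_prob p q n * expR (- (c * t)))%:E.
Proof.
case: n => // n _ t0 kn.
pose i0 : nat -> int := fun=> 0.
rewrite (@prob_split_step 0 i0); first last.
- by move=> w [[Y0 _ _] _] [|].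
- by apply: measurableI => //; exact: measurable_first_return.
have E y : first_return n.+1 `&` [set w | (t%:E < holding_time (X^~ w) k)%E] `&`
    [set w | Y 1 w = y] = excursion 1 n (extend i0 0 y) k t.
  rewrite /excursion follows_extend add1n; apply/seteqP; split => w /=.
    by move=> [[[Y0 Yj Yn] tS] Yy]; split => //; split => // -[].
  by move=> [[fw Yy] Yj Yn tS]; split => //; split => //; split => //; exact: fw.
rewrite !E !prob_excursion ?add1n // !path_weight_extend jump_matrix_up jump_matrix_down.
rewrite /path_weight big_ord0 /extend /= /step_up /step_down /= -EFinD.
by congr (_%:E); ring.
Qed.

Lemma prob_first_return n : (0 < n)%N -> P (first_return n) = (return_prob p q n)%:E.
Proof.
move=> n0; have := prob_first_return_holding n0 (lexx 0) (leq0n n).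
rewrite mulr0 oppr0 expR0 mulr1 => <-; congr (P _).
apply/seteqP; split => w /= [] // ? ? ?; split => //.
exact: holding_time_gt0 (ctmc_right_continuous hX w) 0.
Qed.

Lemma trivIset_first_return : trivIset [set n | (0 < n)%N] first_return.
Proof.
apply/trivIsetP => m n m0 n0 mn; apply/seteqP; split => w //=.
move=> [[_ hm wm] [_ hn wn]].
by case: (ltngtP m n) mn => // h _; [apply: (hn m)|apply: (hm n)] => //; apply/andP.
Qed.

End Excursions.

(** * Moments of the return time *)

Lemma nneseries_EFin_le {R : realType} (u : nat -> R) (C : R) :
  (forall n, 0 <= u n) -> (forall n, \sum_(m < n) u m <= C) ->
  (\sum_(0 <= n <oo) (u n)%:E <= C%:E)%E.
Proof.
move=> u0 uC; apply: lime_le.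
  by apply: is_cvg_nneseries => n _ _; rewrite lee_fin.
by apply: nearW => n; rewrite big_mkord sumEFin lee_fin.
Qed.

(** The series counts the naturals below [v]. It bounds the mean of a holding time by its tail
    probabilities at integers. *)
Lemma le_sum_indicators {R : realType} (v : \bar R) : (0 <= v)%E ->
  (v <= \sum_(0 <= j <oo) (j%:R%:E < v)%E%:R%:E)%E.
Proof.
move=> v0; set S := (X in (_ <= X)%E).
have partial J : (Order.min v J%:R%:E <= \sum_(0 <= j < J) (j%:R%:E < v)%E%:R%:E)%E.
  elim: J => [|J IH]; first by rewrite big_geq // ge_min lexx orbT.
  rewrite big_nat_recr //=; have [Jv|vJ] := ltP J%:R%:E v.
    move: IH; rewrite (min_idPr (ltW Jv)) => IH.
    by rewrite ge_min -natr1 EFinD leeD ?orbT.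
  move: IH; rewrite (min_idPl vJ) => IH.
  by rewrite adde0 ge_min IH.
have partialS J : (Order.min v J%:R%:E <= S)%E.
  by apply: le_trans (partial J) _; apply: nneseries_lim_ge => j _ _; rewrite lee_fin.
case: v v0 @S partial partialS => [v| |] // v0 S _ hS.
  have vJ : v <= (Num.truncn v).+1%:R by apply/ltW/truncnS_gt.
  have := hS (Num.truncn v).+1.
  by rewrite (min_idPl _) // lee_fin.
rewrite leye_eq; apply/eqP/eqyP => A A0.
have AJ : A <= (Num.truncn A).+1%:R by apply/ltW/truncnS_gt.
apply: le_trans (hS (Num.truncn A).+1); rewrite (min_idPr (leey _)).
by rewrite lee_fin.
Qed.

(** This is [u ^ a <= 1 + u] at [u = v / n]. The scaling by [n] suits a sum [v] of [n] holding times
    and retains the order [n ^ a]. *)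
Lemma poweR_le_linear {R : realType} (a : R) (n : nat) (v : \bar R) :
  0 < a <= 1 -> (0 < n)%N -> (0 <= v)%E ->
  (v `^ a <= (n%:R `^ a)%:E * (1 + n%:R^-1%:E * v))%E.
Proof.
move=> /andP[a0 a1] n0; have n0' : 0 < n%:R :> R by rewrite ltr0n.
case: v => [v| |] //; last first.
  have -> : (n%:R^-1%:E * +oo)%E = +oo%E :> \bar R.
    by rewrite gt0_muley // lte_fin invr_gt0.
  rewrite addey // => _; rewrite (@gt0_muley _ (n%:R `^ a)%:E) ?leey //.
  by rewrite lte_fin powR_gt0.
rewrite !lee_fin => v0; have -> : v = n%:R * (n%:R^-1 * v).
  by rewrite mulVKf // gt_eqF.
have u0 : 0 <= n%:R^-1 * v by rewrite mulr_ge0 // invr_ge0 ltW.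
rewrite powRM // mulKf ?gt_eqF // ler_wpM2l ?powR_ge0 //.
have [u1|/ltW u1] := leP 1 (n%:R^-1 * v).
  by apply: le_trans (ler1_powR u1 a1) _; rewrite lerDr.
apply: (@le_trans _ _ (1 `^ a)); last by rewrite powR1 lerDl.
by rewrite ge0_ler_powR ?nnegrE // ltW.
Qed.

(** The number [B] of terms exceeding 1 is at most both their sum and [n], and [B <= n] gives
    [B / sqrt n <= sqrt B]. The bound is linear in the indicators, hence easy to integrate. *)
Lemma sqrt_ge_indicators {R : realType} (n : nat) (S : nat -> \bar R) :
  (0 < n)%N -> (forall k, (0 <= S k)%E) ->
  ((Num.sqrt n%:R)^-1%:E * \sum_(k < n) (1%:E < S k)%E%:R%:E
    <= (\sum_(k < n) S k) `^ 2^-1)%E.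
Proof.
move=> n0 S0; pose B : R := \sum_(k < n) (1%:E < S k)%E%:R.
have n0' : 0 < Num.sqrt n%:R :> R by rewrite sqrtr_gt0 ltr0n.
have B0 : 0 <= B by apply: sumr_ge0.
have BS : (B%:E <= \sum_(k < n) S k)%E.
  rewrite /B -sumEFin; apply: lee_sum => k _.
  by case: ltP => [/ltW|_] //=.
have Bn : B <= n%:R.
  rewrite -[X in _ <= X%:R]card_ord -sumr_const; apply: ler_sum => k _.
  by rewrite lern1 leq_b1.
have i2 : 0 <= 2^-1 :> R by rewrite invr_ge0.
apply: (@le_trans _ _ (B%:E `^ 2^-1)%E); last first.
  by apply: gt0_ler_poweR => //; rewrite in_itv /= ?leey ?andbT // (le_trans _ BS) // lee_fin.
rewrite sumEFin -/B -EFinM lee_fin /= powR12_sqrt // mulrC ler_pdivrMr //.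
rewrite -[X in X <= _]sqr_sqrtr // expr2 ler_wpM2l ?sqrtr_ge0 //.
by rewrite ler_sqrt // ler0n.
Qed.

(** * Comparison of the moments of [tau] with those of the number of jumps *)

Section ReturnTimeMoments.
Context {R : realType} {d : measure_display} {T : measurableType d}.
Variables (P : probability T R) (r s : R).
Hypotheses (hr : 0 < r) (hs : 0 < s).
Let c := r + s.
Let p := r / c.
Let q := s / c.
Variable X : R -> T -> int.
Hypothesis hX : ctmc P (fun i : int => (i == 0)%:R)
  (birth_death_Q (alternating_birth r s) (alternating_death r s)) X.

Let f := return_prob p q.
(** A return takes at least two jumps: [f] vanishes at 0 and 1. *)
Let F n := first_return X n.+2.
Let tau w := return_time 0 (X^~ w).
Let S k w := holding_time (X^~ w) k.

Let c0 : 0 < c. Proof. exact: addr_gt0. Qed.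
Let p0 : 0 < p. Proof. exact: divr_gt0. Qed.
Let q0 : 0 < q. Proof. exact: divr_gt0. Qed.
Let pq1 : p + q = 1. Proof. by rewrite /p /q -mulrDl divff // gt_eqF. Qed.
Let f0 n : 0 <= f n. Proof. exact: return_prob_ge0. Qed.
Let f1 : f 1%N = 0. Proof. by rewrite /f /= !mulr0 addr0. Qed.
Let mF n : measurable (F n).
Proof. exact: measurable_first_return hX _. Qed.
Let PF n : P (F n) = (f n.+2)%:E.
Proof. exact: prob_first_return. Qed.
Let mtau : measurable_fun setT tau.
Proof.
exact: measurable_return_time (ctmc_measurable hX) (ctmc_right_continuous hX) 0.
Qed.
Let mtaua a : measurable_fun setT (fun w => (tau w `^ a)%E).
Proof. exact: (measurableT_comp (measurable_poweR _)). Qed.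
Let tau0 w : (0 <= tau w)%E. Proof. exact: return_time_ge0. Qed.
Let S0 k w : (0 <= S k w)%E.
Proof. exact/ltW/holding_time_gt0/(ctmc_right_continuous hX). Qed.
Let mS k t : measurable [set w | (t%:E < S k w)%E].
Proof.
exact: measurable_holding_time_gt (ctmc_measurable hX) (ctmc_right_continuous hX) k t.
Qed.
Let trivF : trivIset setT F.
Proof.
apply/trivIsetP => m n _ _ mn.
by have /trivIsetP := @trivIset_first_return _ _ _ X; apply => //; rewrite eqSS.
Qed.

Lemma sum_return_prob_shift (u : nat -> R) n :
  \sum_(m < n) f m.+2 * u m.+2 = \sum_(m < n.+2) f m * u m.
Proof. by rewrite !big_ord_recl f1 /= !mul0r !add0r. Qed.

Lemma first_return_ae : P (\bigcup_n F n) = 1%E.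
Proof.
have mU : measurable (\bigcup_n F n) by exact: bigcupT_measurable.
apply/eqP; rewrite eq_le probability_le1 //=.
apply/lee_addgt0Pr => e e0.
have [n0 /(_ n0.+2 (leqW (leqnSn n0)))] := sum_return_prob_ge p0 q0 pq1 e0.
rewrite -/f => h; rewrite -leeBlDr //; apply: (@le_trans _ _ (\sum_(m < n0) f m.+2)%:E).
  have := sum_return_prob_shift (fun=> 1) n0.
  under eq_bigr do rewrite mulr1; under [RHS]eq_bigr do rewrite mulr1.
  by move=> ->; rewrite lee_fin.
rewrite measure_bigcup // -sumEFin.
apply: le_trans (nneseries_lim_ge n0 _); last by [].
rewrite big_mkord; under [leRHS]eq_bigl do rewrite in_setT.
by apply: lee_sum => m _; rewrite [leRHS]PF.
Qed.

Lemma integral_return_time_pow a :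
  (\int[P]_w (tau w `^ a) = \sum_(0 <= n <oo) \int[P]_(w in F n) (tau w `^ a))%E.
Proof.
have mU : measurable (\bigcup_n F n) by exact: bigcupT_measurable.
rewrite (ge0_negligible_integral (N := ~` \bigcup_n F n)) //.
- rewrite setTD setCK ge0_integral_bigcup //.
  + exact: measurable_funS (mtaua a).
  + by move=> w _; exact: poweR_ge0.
- exact: measurableC.
- by move=> w _; exact: poweR_ge0.
- by apply: etrans (probability_setC P mU) _; rewrite first_return_ae subee.
Qed.

Let prob_FS n k t : 0 <= t -> (k <= n.+2)%N ->
  (\int[P]_(w in F n) (t%:E < S k w)%E%:R%:E = (f n.+2 * expR (- (c * t)))%:E)%E.
Proof.
move=> t0 kn; rewrite -(prob_first_return_holding hr hs hX (ltn0Sn n.+1) t0 kn) setIC -integral_indic.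
- by apply: eq_integral => w _; rewrite indicE mem_setE.
- exact: mF.
- exact: mS.
Qed.

Let mind k t D : measurable_fun D (fun w => ((t%:E < S k w)%E%:R : R)%:E).
Proof.
rewrite (_ : (fun w => _) = EFin \o (\1_[set w | (t%:E < S k w)%E] : T -> R)).
  by apply: measurableT_comp => //; exact: measurable_indic.
by apply/funext => w /=; rewrite indicE mem_setE.
Qed.

Let tau_sum n w : F n w -> tau w = (\sum_(k < n.+2) S k w)%E.
Proof.
move=> [Y0 Yj Yn]; have rcw := ctmc_right_continuous hX w.
rewrite -(jump_time_sum rcw).
by apply/eqP; rewrite eq_le return_time_le // return_time_ge.
Qed.

(** Each of the [n + 2] holding times exceeds 1 on a part of [F n] of probability
    [f n.+2 * expR (- c)]; dividing the expected count by the square root of [n + 2] leaves that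
    square root. *)
Lemma integral_sqrt_return_time_ge n :
  ((expR (- c) * (f n.+2 * Num.sqrt n.+2%:R))%:E
    <= \int[P]_(w in F n) (tau w `^ 2^-1))%E.
Proof.
have n0 : 0 < Num.sqrt n.+2%:R :> R by rewrite sqrtr_gt0 ltr0n.
apply: (@le_trans _ _ (\int[P]_(w in F n)
    ((Num.sqrt n.+2%:R)^-1%:E * \sum_(k < n.+2) (1%:E < S k w)%E%:R%:E))%E).
  rewrite ge0_integralZl_EFin ?invr_ge0 ?(ltW n0) //; last 2 first.
  - by move=> w _; apply: sume_ge0 => k _; rewrite lee_fin.
  - by apply: emeasurable_sum => k; exact: mind.
  rewrite ge0_integral_sum //.
  rewrite (eq_bigr (fun=> (f n.+2 * expR (- c))%:E)); last first.
    by move=> k _; rewrite prob_FS ?mulr1 // ltnW.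
  rewrite sumEFin sumr_const card_ord -EFinM lee_fin -[X in _ <= _ * X]mulr_natr.
  rewrite -[X in _ <= _ * (_ * X)](sqr_sqrtr (ler0n R n.+2)) le_eqVlt; apply/orP; left; apply/eqP.
  by field; rewrite gt_eqF.
apply: ge0_le_integral => //.
- move=> w _; apply: mule_ge0; first by rewrite lee_fin invr_ge0 ltW.
  by apply: sume_ge0 => k _; rewrite lee_fin.
- by apply: measurable_funeM; apply: emeasurable_sum => k; exact: mind.
- exact: measurable_funS (mtaua _).
- by move=> w Fw; rewrite (tau_sum Fw); exact: sqrt_ge_indicators (S0^~ w).
Qed.

(** Each holding time contributes at most [f n.+2] times a geometric series of ratio [expR (- c)].
    The sum of [n + 2] such terms cancels the factor [n.+2%:R^-1] of the linear bound. *)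
Lemma integral_return_time_pow_le n a : 0 < a <= 1 ->
  (\int[P]_(w in F n) (tau w `^ a)
    <= ((1 + (1 - expR (- c))^-1) * (f n.+2 * n.+2%:R `^ a))%:E)%E.
Proof.
move=> a01; pose K := (1 - expR (- c))^-1.
pose h w := (\sum_(k < n.+2) \sum_(0 <= j <oo) (j%:R%:E < S k w)%E%:R%:E)%E : \bar R.
have ec1 : 0 < 1 - expR (- c) by rewrite subr_gt0 -expR0 ltr_expR oppr_lt0.
have ser0 k w : (0 <= \sum_(0 <= j <oo) (j%:R%:E < S k w)%E%:R%:E :> \bar R)%E.
  by apply: nneseries_ge0 => j _ _; rewrite lee_fin.
have h0 w : (0 <= h w)%E by apply: sume_ge0.
have mser k D : measurable D ->
    measurable_fun D (fun w => \sum_(0 <= j <oo) (j%:R%:E < S k w)%E%:R%:E : \bar R)%E.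
  move=> mD; apply: (@ge0_emeasurable_sum _ _ _ _ _ xpredT) => [j w _ _|j _].
    by rewrite lee_fin.
  exact: mind.
have mh D : measurable D -> measurable_fun D h.
  by move=> mD; apply: emeasurable_sum => k; exact: mser.
have n2 : 0 < n.+2%:R :> R by rewrite ltr0n.
apply: (@le_trans _ _ (\int[P]_(w in F n)
    ((n.+2%:R `^ a)%:E * (1 + n.+2%:R^-1%:E * h w)))%E).
  apply: ge0_le_integral => //.
  - by move=> w _; exact: poweR_ge0.
  - exact: measurable_funS (mtaua _).
  - apply: measurable_funeM; apply: emeasurable_funD => //.
    by apply: measurable_funeM; exact: mh.
  - move=> w Fw; have th : (tau w <= h w)%E.
      by rewrite (tau_sum Fw); apply: lee_sum => k _; exact: le_sum_indicators.
    have /andP[/ltW a0 _] := a01.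
    apply: le_trans (poweR_le_linear a01 _ (h0 w)) => //.
    by apply: gt0_ler_poweR => //; rewrite in_itv /= leey andbT.
have mnh : measurable_fun (F n) (fun w => n.+2%:R^-1%:E * h w)%E.
  by apply: measurable_funeM; exact: mh.
have nh0 w : (0 <= n.+2%:R^-1%:E * h w)%E.
  by apply: mule_ge0 => //; rewrite lee_fin invr_ge0 ltW.
rewrite ge0_integralZl_EFin ?powR_ge0 //; last 2 first.
- by move=> w _; apply: adde_ge0.
- exact: emeasurable_funD.
rewrite ge0_integralD // integral_cst // mul1e.
rewrite [X in (_ * (X + _))%E](PF n).
rewrite ge0_integralZl_EFin ?invr_ge0 ?(ltW n2) //; last exact: mh.
have -> : (\int[P]_(w in F n) h w = \sum_(k < n.+2)
    \sum_(0 <= j <oo) (f n.+2 * expR (- (c * j%:R)))%:E)%E.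
  rewrite ge0_integral_sum //; last by move=> k; exact: mser.
  apply: eq_bigr => k _; rewrite integral_nneseries //.
  by apply: eq_eseriesr => j _; rewrite prob_FS // ltnW.
have serK : (\sum_(0 <= j <oo) (f n.+2 * expR (- (c * j%:R)))%:E <= (f n.+2 * K)%:E)%E.
  apply: nneseries_EFin_le => [j|N]; first by rewrite mulr_ge0 ?expR_ge0.
  rewrite -mulr_sumr ler_wpM2l // /K -[X in _ <= X]mul1r ler_pdivlMr //.
  under eq_bigr do rewrite -mulNr expRM_natr.
  have := subrX1 (expR (- c)) N; have : 0 <= expR (- c) ^+ N by rewrite exprn_ge0 ?expR_ge0.
  by move: (\sum_(i < N) _) (expR (- c) ^+ N) => A B; lra.
apply: (@le_trans _ _ ((n.+2%:R `^ a)%:E * ((f n.+2)%:E + n.+2%:R^-1%:E *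
   \sum_(k < n.+2) (f n.+2 * K)%:E))%E).
  rewrite lee_pmul2l ?lte_fin ?powR_gt0 // leeD2l // lee_pmul2l ?lte_fin ?invr_gt0 //.
  exact: lee_sum.
rewrite sumEFin sumr_const card_ord -[(f _ * K) *+ _]mulr_natl -!EFinM lee_fin.
rewrite mulKf ?gt_eqF // le_eqVlt; apply/orP; left; apply/eqP.
by rewrite -/K; ring.
Qed.

Lemma return_time_moment_finite a : 0 < a < 2^-1 ->
  (\int[P]_w (tau w `^ a) < +oo)%E.
Proof.
move=> ha; have [a0 a2] := andP ha.
have [C hC] := return_moment_bounded p0 q0 pq1 ha.
pose K := 1 + (1 - expR (- c))^-1.
have K0 : 0 <= K.
  by rewrite addr_ge0 // invr_ge0 subr_ge0 -expR0 ler_expR oppr_le0 ltW.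
apply: (@le_lt_trans _ _ (K * C)%:E); last exact: ltry.
rewrite integral_return_time_pow.
apply: (@le_trans _ _ (\sum_(0 <= n <oo) (K * (f n.+2 * n.+2%:R `^ a))%:E)%E).
  apply: lee_nneseries => [n _ _|n _].
    by apply: integral_ge0 => w _; exact: poweR_ge0.
  by apply: integral_return_time_pow_le; rewrite a0; lra.
apply: nneseries_EFin_le => [n|n].
  by rewrite mulr_ge0 // mulr_ge0 // powR_ge0.
by rewrite -mulr_sumr ler_wpM2l // (sum_return_prob_shift (fun m => m%:R `^ a)).
Qed.

Lemma sqrt_return_time_moment_infinite :
  (\int[P]_w (tau w `^ 2^-1) = +oo)%E.
Proof.
apply/eqP; rewrite -leye_eq leNgt; apply/negP => I.
have I0 : (0 <= \int[P]_w (tau w `^ 2^-1))%E.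
  by apply: integral_ge0 => w _; exact: poweR_ge0.
have Ifin : (\int[P]_w (tau w `^ 2^-1))%E \is a fin_num by rewrite ge0_fin_numE.
have e0 := expR_gt0 (- c).
apply: (return_sqrt_moment_unbounded p0 q0 pq1
  (C := (expR (- c))^-1 * fine (\int[P]_w (tau w `^ 2^-1))%E)) => n.
rewrite ler_pdivlMl // -lee_fin fineK //.
apply: (@le_trans _ _ (\sum_(m < n) (expR (- c) * (f m.+2 * Num.sqrt m.+2%:R))%:E)%E).
  rewrite sumEFin lee_fin -mulr_sumr ler_wpM2l ?(ltW e0) //.
  rewrite (sum_return_prob_shift (fun m => Num.sqrt m%:R)).
  apply: (@ler_sum_ord _ (fun m => f m * Num.sqrt m%:R)); last exact: leqW.
  by move=> m; rewrite mulr_ge0 ?sqrtr_ge0.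
rewrite integral_return_time_pow.
apply: (@le_trans _ _ (\sum_(0 <= m < n) \int[P]_(w in F m) (tau w `^ 2^-1))%E).
  rewrite big_mkord; apply: lee_sum => m _; exact: integral_sqrt_return_time_ge.
apply: nneseries_lim_ge => m _ _.
by apply: integral_ge0 => w _; exact: poweR_ge0.
Qed.

(** Reduction to the exponent 1/2 through [v ^ (1/2) <= 1 + v ^ a], the measure being finite. *)
Lemma return_time_moment_infinite a : 2^-1 <= a ->
  (\int[P]_w (tau w `^ a) = +oo)%E.
Proof.
move=> a2; have a0 : 0 < a by lra.
apply/eqP; rewrite -leye_eq -sqrt_return_time_moment_infinite leNgt.
apply/negP => I.
have : (\int[P]_w (tau w `^ 2^-1) <= \int[P]_w (1 + tau w `^ a))%E.
  apply: ge0_le_integral => //.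
  - by move=> w _; exact: poweR_ge0.
  - exact: emeasurable_funD.
  - move=> w _; have := tau0 w; case: (tau w) => [v| |] // v0; last first.
      by rewrite [(+oo `^ a)%E]poweRyr ?gt_eqF // addey // leey.
    rewrite /= -EFinD lee_fin; have [v1|/ltW v1] := leP 1 v.
      by apply: le_trans (ler_powR v1 a2) _; rewrite lerDr.
    apply: (@le_trans _ _ (1 `^ 2^-1)); last by rewrite powR1 lerDl powR_ge0.
    by rewrite ge0_ler_powR ?nnegrE // invr_ge0.
rewrite ge0_integralD //; last by move=> w _; exact: poweR_ge0.
rewrite integral_cst // mul1e [X in (_ <= X + _)%E](probability_setT P).
rewrite sqrt_return_time_moment_infinite in I *.
by rewrite leye_eq => /eqP E; have := lte_add_pinfty (ltry 1) I; rewrite E ltxx.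
Qed.

End ReturnTimeMoments.

Theorem theorem5p5 (R : realType) (d : measure_display) (T : measurableType d)
    (P : probability T R) (r s : R) (hr : 0 < r) (hs : 0 < s)
    (X : R -> T -> int)
    (hX : ctmc P (fun i : int => (i == 0)%:R)
            (birth_death_Q (alternating_birth r s) (alternating_death r s)) X)
    (a : R) (ha : 0 < a) :
  (\int[P]_w (return_time 0%Z (X^~ w) `^ a) < +oo)%E <-> 0 < a < 2^-1.
Proof.
split=> [fin|]; last by move=> h; have := return_time_moment_finite hr hs hX h.
rewrite ha ltNge; apply/negP => a2.
by move: fin; rewrite (return_time_moment_infinite hr hs hX a2).
Qed.
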